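(* Let $F(X)\in\mathbb{Z}[X]$ satisfy the standing assumptions below, and let $G(x)=ax+b$ where $a,b$ are positive integers with $\gcd(a,b)=1$. Then the asymptotic density of the set $\mathscr{A}_{F,G,1}=\{n\ge1:\gcd(an+b,a_n)=1\}$ exists and is positive.
   Context: Standing assumptions: $F(X)\in\mathbb{Z}[X]$ has positive leading coefficient and degree at least $2$. Define $a_0=0$ and $a_n=F(a_{n-1})$ for $n\ge1$; it is assumed that the sequence $(a_n)$ is unbounded ($0$ is a wandering point). The asymptotic density of $\mathcal S\subseteq\mathbb{Z}_{>0}$ is $\lim_{x\to\infty}\#(\mathcal S\cap[1,x])/x$ when it exists. *)

(* Defs.v *)
From mathcomp Require Import all_boot all_order all_algebra.
From mathcomp Require Import all_classical all_reals all_analysis.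
Import Order.TTheory GRing.Theory Num.Theory.
Import numFieldNormedType.Exports.

Set Implicit Arguments.
Unset Strict Implicit.
Unset Printing Implicit Defensive.

Local Open Scope classical_set_scope.
Local Open Scope ring_scope.

Definition zero_orbit (F : {poly int}) (n : nat) : int :=
  iter n (fun x : int => F.[x]) 0.

Definition unbounded_seq (u : nat -> int) : Prop :=
  forall M : int, exists n : nat, M < `|u n|.

(* For x >= 0 the integers in [1, x] are those of iota 1 (truncn x). *)
Definition counting_fun (R : realType) (S : set nat) (x : R) : nat :=
  count (fun n => n \in S) (iota 1 (Num.truncn x)).

Definition has_density (R : realType) (S : set nat) (d : R) : Prop :=
  (counting_fun S x)%:R / x @[x --> +oo%R] --> d.

(* G n = a n + b is evaluated in nat and then cast to int. *)
Definition coprime_set (F : {poly int}) (a b : nat) : set nat :=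
  [set n | (1 <= n)%N /\ gcdz (a * n + b)%N%:Z (zero_orbit F n) = 1].

(* Main.v *)
Require Import Defs.
From mathcomp Require Import all_boot all_order all_algebra.
From mathcomp Require Import all_classical all_reals all_analysis.
From mathcomp Require Import zify ring lra.
Import Order.TTheory GRing.Theory Num.Theory.
Import numFieldNormedType.Exports.
Local Open Scope classical_set_scope.
Local Open Scope ring_scope.

(* Let z(p) be the rank of apparition of the prime p in the orbit of 0, so that
   p divides a_n iff z(p) divides n, with z(p) = 0 when p divides no a_n, n > 0;
   moreover z(p) <= p. Then n is bad iff, for some prime p,
   p divides a n + b and z(p) > 0 divides n; if p > b this fixes n modulo
   p z(p). Since |a_n| is at most doubly exponential in n, few primes have small
   rank, and with Chebyshev's upper bound the sum of 1 / (p z(p)) converges.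
   Hence the n that are bad because of a prime p >= P have small upper density:
   the moduli p z(p) <= x contribute O(x) times the tail of that sum, and each
   larger one at most one n, so O(pi(a x + b)) = o(x) in total. The n that are
   good for all p < P form a periodic set, which yields existence of the
   density. For positivity, restrict to a class c modulo M, where M has exactly
   the prime factors p < P and a c + b is prime to M. *)

(** * Chebyshev's upper bound for the number of primes *)

Lemma prod_primes_dvdn (s : seq nat) (N : nat) :
  uniq s -> all prime s -> (forall p, p \in s -> (p %| N)%N) ->
  (\prod_(p <- s) p %| N)%N.
Proof.
elim: s => [|p s IHs] /=; first by rewrite big_nil dvd1n.
move=> /andP[ps us] /andP[p_pr s_pr] dvds; rewrite big_cons Gauss_dvd.
  rewrite dvds ?mem_head// IHs// => q qs.
  by apply: dvds; rewrite in_cons qs orbT.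
rewrite prime_coprime//; apply: contra ps; rewrite Euclid_dvd_prod// big_has => /hasP[q qs].
by rewrite dvdn_prime2 ?(allP s_pr q qs)// => /eqP->.
Qed.

Lemma expn_size_primes_le (s : seq nat) (m N : nat) :
  uniq s -> all prime s -> (0 < N)%N ->
  (forall p, p \in s -> (m <= p)%N && (p %| N)%N) -> (m ^ size s <= N)%N.
Proof.
move=> us s_pr N_gt0 hs.
apply: (@leq_trans (\prod_(p <- s) p)%N); last first.
  by apply: dvdn_leq => //; apply: prod_primes_dvdn => // p /hs/andP[].
rewrite -sum1_size expn_sum big_seq [leqRHS]big_seq.
by apply: leq_prod => p /hs/andP[]; rewrite expn1.
Qed.

Lemma prime_dvd_fact (p n : nat) : prime p -> (p %| n`!)%N = (p <= n)%N.
Proof.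
move=> p_pr; apply/idP/idP => [|le_pn]; last by rewrite dvdn_fact// prime_gt0.
elim: n => [|n IHn]; first by rewrite fact0 Euclid_dvd1.
rewrite factS Euclid_dvdM// => /orP[/dvdn_leq->//|/IHn/leq_trans->//].
Qed.

Lemma prime_dvd_central_bin (p m : nat) :
  prime p -> (m < p <= m.*2)%N -> (p %| 'C(m.*2, m))%N.
Proof.
move=> p_pr /andP[mp pm].
have : (p %| (m.*2)`!)%N by rewrite prime_dvd_fact.
have le_m : (m <= m.*2)%N by lia.
rewrite -(bin_fact le_m) !Euclid_dvdM//.
have -> : (m.*2 - m = m)%N by lia.
by rewrite !prime_dvd_fact// leqNgt mp /= !orbF.
Qed.

Lemma bin_le_exp2 (n m : nat) : ('C(n, m) <= 2 ^ n)%N.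
Proof.
have [mn|nm] := leqP m n; last by rewrite bin_small.
rewrite -[2%N]/(1 + 1)%N expnDn (bigD1 (inord m : 'I_n.+1))//=.
by rewrite inordK// !exp1n !muln1 leq_addr.
Qed.

(** Every prime in (2^j, 2^(j+1)] divides the central binomial coefficient of 2^(j+1), which is at
    most 2^(2^(j+1)), and each such prime exceeds 2^j. *)
Lemma count_primes_dyadic (j : nat) :
  (j * count prime (index_iota (2 ^ j).+1 (2 ^ j.+1).+1) <= 2 ^ j.+1)%N.
Proof.
rewrite -size_filter; set s := [seq p <- _ | _].
suff : ((2 ^ j) ^ size s <= 2 ^ (2 ^ j.+1))%N.
  by rewrite -expnM leq_exp2l.
have -> : (2 ^ j.+1 = (2 ^ j).*2)%N by rewrite expnS mul2n.
apply: leq_trans (bin_le_exp2 _ (2 ^ j)).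
apply: expn_size_primes_le.
- by rewrite filter_uniq// iota_uniq.
- exact: filter_all.
- by rewrite bin_gt0; lia.
- move=> p; rewrite mem_filter mem_index_iota ltnS => /andP[p_pr lep].
  rewrite prime_dvd_central_bin//; first by case/andP: lep => /ltnW->.
  by move: lep; rewrite expnS mul2n.
Qed.

Lemma count_index_iota_cat (P : pred nat) (m n q : nat) :
  (m <= n <= q)%N ->
  count P (index_iota m q) =
  (count P (index_iota m n) + count P (index_iota n q))%N.
Proof.
move=> /andP[mn nq]; rewrite -count_cat /index_iota; congr count.
have -> : (q - m = (n - m) + (q - n))%N by lia.
by rewrite iotaD; congr (_ ++ iota _ _); lia.
Qed.

(** Up to 2^i the count is trivial; each later dyadic block has index at least [i], so its bound
    with factor [j] also holds with factor [i], and the blocks add up geometrically. *)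
Lemma count_primes_exp2 (i K : nat) : (i <= K)%N ->
  (i * count prime (index_iota 0 (2 ^ K).+1) <= i * (2 ^ i).+1 + 2 ^ K.+1)%N.
Proof.
elim: K => [|K IHK]; first by rewrite leqn0 => /eqP->.
rewrite leq_eqVlt => /orP[/eqP->|].
  apply: leq_trans (leq_addr _ _); rewrite leq_mul2l; apply/orP; right.
  by apply: leq_trans (count_size _ _) _; rewrite size_iota subn0.
rewrite ltnS => iK.
rewrite (@count_index_iota_cat _ _ (2 ^ K).+1); last first.
  by rewrite /= ltnS leq_exp2l.
have := IHK iK; have := count_primes_dyadic K.
set u := count _ _; set v := count _ _ => hu hv.
have : (i * u <= K * u)%N by rewrite leq_mul2r iK orbT.
rewrite mulnDr [(2 ^ K.+2)%N]expnS; lia.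
Qed.

Lemma count_primes_le (i N : nat) :
  (i * count prime (index_iota 0 N.+1) <= i * (2 ^ i).+1 + 4 * N)%N.
Proof.
have [Ni|iN] := leqP N (2 ^ i).
  apply: leq_trans (leq_addr _ _); rewrite leq_mul2l; apply/orP; right.
  apply: leq_trans (count_size _ _) _; rewrite size_iota subn0; lia.
have N_gt1 : (1 < N)%N by apply: leq_ltn_trans iN; rewrite expn_gt0.
(* Rounding [N] up to a power of two costs a factor less than 2, whence the constant 4. *)
have [K [K1 K2 iK]] : exists K, [/\ (N <= 2 ^ K)%N, (2 ^ K < 2 * N)%N & (i <= K)%N].
  have /andP[h1 h2] := up_log_bounds (isT : (1 < 2)%N) N_gt1.
  have up_gt0 : (0 < up_log 2 N)%N by rewrite up_log_gt0.
  exists (up_log 2 N); split=> //.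
    by rewrite -(prednK up_gt0) expnS ltn_mul2l.
  by rewrite -(leq_exp2l (m:=2))//; apply: leq_trans h2; apply: ltnW.
apply: (@leq_trans (i * count prime (index_iota 0 (2 ^ K).+1))).
  by rewrite leq_mul2l (@count_index_iota_cat _ _ N.+1 (2 ^ K).+1) ?leq_addr ?orbT.
apply: leq_trans (count_primes_exp2 _ _ iK) _.
rewrite expnS; lia.
Qed.

Lemma count_primes_little_o (R : realType) (e : R) : 0 < e ->
  exists C : R, forall N : nat,
    (count prime (index_iota 0 N.+1))%:R <= e * N%:R + C.
Proof.
move=> e_gt0; pose i := (Num.truncn (4 / e)).+1.
exists (2 ^ i).+1%:R => N.
have i_gt : 4 / e < i%:R by apply: truncnS_gt.
have ie : 4 <= e * i%:R by rewrite mulrC -ler_pdivrMr// ltW.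
have i_gt0 : (0 : R) < i%:R by rewrite ltr0n.
have := count_primes_le i N; rewrite -(ler_nat R) natrD !natrM => h.
rewrite -(ler_pM2l i_gt0); apply: le_trans h _.
rewrite mulrDr addrC lerD2r mulrA [_ * e]mulrC ler_wpM2r//.
Qed.

(** * Divisibility and growth in the orbit of 0 *)

Lemma dvdz_hornerB (F : {poly int}) (x y : int) :
  (x - y %| F.[x] - F.[y])%Z.
Proof.
have /factor_theorem[q Fq] : root (F - F.[y]%:P) y.
  by rewrite /root !hornerE subrr.
have := congr1 (horner^~ x) Fq; rewrite !hornerE => ->.
exact: dvdz_mull.
Qed.

Lemma zero_orbit_congr (F : {poly int}) (d : int) (i j k : nat) :
  (d %| zero_orbit F i - zero_orbit F j)%Z ->
  (d %| zero_orbit F (k + i) - zero_orbit F (k + j))%Z.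
Proof.
move=> dij; elim: k => // k /dvdz_trans; apply.
exact: dvdz_hornerB.
Qed.

(** Take the least z > 0 with p dividing a_z, or 0 if there is none. Since a_z is congruent to a_0 =
    0, the orbit has period z modulo p, which settles divisibility. *)
Lemma rank_of_apparition (F : {poly int}) (p : nat) : (0 < p)%N ->
  exists z : nat,
    (z <= p)%N /\ forall n, (p%:Z %| zero_orbit F n)%Z = (z %| n)%N.
Proof.
move=> p_gt0; pose u := zero_orbit F.
have [none|/existsNP[z0]] :=
    pselect (forall n, ~~ ((0 < n)%N && (p%:Z %| u n)%Z)).
  exists 0%N; split=> // -[|n]; first by rewrite dvdn0 dvdz0.
  by rewrite dvd0n; apply/negbTE; have := none n.+1.
move=> /negP; rewrite negbK => pz0.
have ex_z : exists n, (0 < n)%N && (p%:Z %| u n)%Z by exists z0.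
case: (ex_minnP ex_z) => z /andP[z_gt0 pz] z_min.
have z_le n : (0 < n)%N -> (p%:Z %| u n)%Z -> (z <= n)%N.
  by move=> n0 pn; apply: z_min; rewrite n0.
exists z; split; last first.
  have addz n : (p%:Z %| u (n + z)%N)%Z = (p%:Z %| u n)%Z.
    have : (p%:Z %| u (n + z)%N - u (n + 0)%N)%Z.
      by apply: zero_orbit_congr; rewrite subr0.
    by rewrite addn0 => h; rewrite -(rpredDl (u n) h) subrK.
  have addqz q n : (p%:Z %| u (n + q * z)%N)%Z = (p%:Z %| u n)%Z.
    by elim: q => [|q IHq]; rewrite ?addn0// mulSnr addnA addz.
  move=> n; rewrite {1}(divn_eq n z) addnC addqz /dvdn.
  case: (posnP (n %% z)) => [->|r_gt0]; first by rewrite dvdz0.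
  apply: contraTF (ltn_pmod n z_gt0) => /z_le -/(_ r_gt0).
  by rewrite -leqNgt.
(* Pigeonhole: it suffices that a_0, ..., a_(z-1) are distinct modulo p. If a_i and a_j agree with i
   < j < z, then z - j further steps make a_(i+z-j) congruent to a_z, hence to 0, against
   minimality. *)
suff us : uniq [seq `|(u i %% p%:Z)%Z|%N | i <- iota 0 z].
  rewrite -[leqLHS](size_iota 0) -(size_map (fun i => `|(u i %% p%:Z)%Z|%N)).
  rewrite -[leqRHS](size_iota 0); apply: uniq_leq_size => // _ /mapP[i _ ->].
  rewrite mem_iota /= add0n -ltz_nat gez0_abs ?modz_ge0 ?ltz_pmod//; lia.
have no_congr i j : (i < j < z)%N -> ~~ (p%:Z %| u i - u j)%Z.
  move=> /andP[ij jz]; apply/negP => /(zero_orbit_congr _ _ _ _ (z - j)).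
  rewrite (subnK (ltnW jz)) rpredBr// => /z_le; lia.
rewrite map_inj_in_uniq ?iota_uniq// => i j.
rewrite !mem_iota /= !add0n => iz jz eq_ij.
have {}eq_ij : (u i == u j %[mod p])%Z.
  apply/eqP; move/(congr1 Posz): eq_ij.
  rewrite !gez0_abs ?modz_ge0//; lia.
case: (ltngtP i j) => // lt_ij.
  by move: eq_ij; rewrite eqz_mod_dvd (negbTE (no_congr i j _)) ?lt_ij.
by move: eq_ij; rewrite eq_sym eqz_mod_dvd (negbTE (no_congr j i _)) ?lt_ij.
Qed.

(** A return to 0 makes the orbit periodic, hence bounded by the sum of the absolute values over one
    period. *)
Lemma zero_orbit_neq0 (F : {poly int}) (k : nat) :
  unbounded_seq (zero_orbit F) -> (0 < k)%N -> zero_orbit F k != 0.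
Proof.
move=> unb k_gt0; apply/eqP => uk; pose u := zero_orbit F.
have addk n : u (n + k)%N = u n by rewrite /u /zero_orbit iterD [iter k _ _]uk.
have addqk q n : u (n + q * k)%N = u n.
  by elim: q => [|q IHq]; rewrite ?addn0// mulSnr addnA addk.
have [n] := unb (\sum_(i < k) `|u i|).
rewrite -/u (divn_eq n k) addnC addqk.
rewrite (bigD1 (Ordinal (ltn_pmod n k_gt0)))//= gtrDl ltNge.
by rewrite sumr_ge0.
Qed.

(** Induction along Horner's scheme: passing from F to F X + c costs a factor |x| and a summand |c|
    < 2^|c|. *)
Lemma horner_exp2_growth (F : {poly int}) :
  exists E : nat, forall (x : int) (t : nat),
    (`|x| <= 2 ^ t)%N -> (`|F.[x]| <= 2 ^ (E * t.+1))%N.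
Proof.
elim/poly_ind: F => [|F c [E hE]].
  by exists 0%N => x t _; rewrite horner0 absz0.
exists (E + 1 + `|c|)%N => x t xt; rewrite !hornerE.
have Fx := hE _ _ xt.
apply: (@leq_trans (2 ^ (E * t.+1) * 2 ^ t * 2 ^ `|c|)); last first.
  rewrite -!expnD leq_exp2l//; nia.
apply: (@leq_trans (`|F.[x] * x| + `|c|)); first by move: (F.[x] * x) => w; lia.
rewrite abszM.
have := leq_mul Fx xt; set y := (2 ^ _ * _)%N => hy.
have y_gt0 : (0 < y)%N by rewrite /y muln_gt0 !expn_gt0.
have := ltn_expl `|c| (isT : (1 < 2)%N); nia.
Qed.

Lemma zero_orbit_growth (F : {poly int}) :
  exists E : nat, forall n : nat, (`|zero_orbit F n| <= 2 ^ (E ^ n))%N.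
Proof.
have [E hE] := horner_exp2_growth F.
exists E.+1 => n.
(* The predecessor in the exponent absorbs the [t.+1] of the one-step bound, so the induction
   closes. *)
suff : (`|zero_orbit F n| <= 2 ^ (E.+1 ^ n).-1)%N.
  by move=> /leq_trans; apply; rewrite leq_exp2l// leq_pred.
elim: n => [|n IHn]; first by rewrite expn0.
apply: leq_trans (hE _ _ IHn) _; rewrite leq_exp2l// prednK ?expn_gt0//.
have : (0 < E.+1 ^ n)%N by rewrite expn_gt0.
by rewrite expnS mulSn; lia.
Qed.

(** * Primes of small rank and convergence of the sum of 1 / (p z(p)) *)

(** All primes of rank between 1 and [y] divide A_1 ... A_y, so their number is at most the binary
    logarithm of this product. *)
Lemma count_small_rank (A z : nat -> nat) (E : nat) :
  (forall n, (0 < n)%N -> (0 < A n)%N) ->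
  (forall n, (A n <= 2 ^ (E ^ n))%N) ->
  (forall p, prime p -> (p %| A (z p))%N) ->
  forall y m n, (count (fun p => prime p && (0 < z p <= y)%N) (index_iota m n)
    <= 2 ^ ((2 * E.+1) * y))%N.
Proof.
move=> A_gt0 A_le zA y m n; rewrite -size_filter; set s := [seq p <- _ | _].
have N_gt0 : (0 < \prod_(1 <= k < y.+1) A k)%N.
  by rewrite big_nat prodn_cond_gt0// => k /andP[k1 _]; apply: A_gt0.
have : (2 ^ size s <= \prod_(1 <= k < y.+1) A k)%N.
  apply: expn_size_primes_le => //.
  - by rewrite filter_uniq// iota_uniq.
  - by apply/allP => p; rewrite mem_filter => /andP[/andP[]].
  - move=> p; rewrite mem_filter => /andP[/andP[p_pr zp] _].
    rewrite prime_gt1//= (dvdn_trans (zA _ p_pr))//.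
    rewrite (bigD1_seq (z p)) ?iota_uniq ?mem_index_iota//=.
    exact: dvdn_mulr.
move=> /leq_trans/(_ (_ : _ <= 2 ^ (y * E.+1 ^ y))%N) h.
have {}h : (size s <= y * E.+1 ^ y)%N.
  rewrite -(leq_exp2l (m := 2))//; apply: h.
  rewrite mulnC expnM.
  apply: (@leq_trans (\prod_(1 <= k < y.+1) 2 ^ (E.+1 ^ y))%N).
    rewrite big_nat [leqRHS]big_nat; apply: leq_prod => k /andP[_ ky].
    apply: leq_trans (A_le k) _; rewrite leq_exp2l//.
    apply: (@leq_trans (E.+1 ^ k)); last by rewrite leq_pexp2l.
    by case: k {ky} => // k; rewrite leq_exp2r.
  by rewrite prod_nat_const_nat subn1.
(* Bounding y by 2^y and then 2 (E + 1) by a power of 2 makes the final exponent linear in [y]. *)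
apply: leq_trans h _; rewrite expnM.
apply: (@leq_trans (2 ^ y * E.+1 ^ y)); first by rewrite leq_mul2r ltnW ?orbT// ltn_expl.
rewrite -expnMn; case: y {s N_gt0} => // y; rewrite leq_exp2r//.
by rewrite ltnW// ltn_expl.
Qed.

Lemma sqr_le_exp2 (n : nat) : (n ^ 2 <= 2 * 2 ^ n)%N.
Proof.
case: n => [|[|[|n]]] //; elim: n => // n IHn.
rewrite [(2 ^ _)%N]expnS; move: IHn; set u := (2 ^ _)%N; rewrite -!mulnn; nia.
Qed.

Section RankSums.
Variables (R : realType) (z : nat -> nat) (e : nat).
Hypothesis e_gt0 : (0 < e)%N.
Hypothesis count_z : forall y m n,
  (count (fun p => prime p && (0 < z p <= y)%N) (index_iota m n)
    <= 2 ^ (e * y))%N.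

(** A prime of rank 0 gets weight 0, because the inverse of 0 is 0. *)
Let w (p : nat) : R := (p * z p)%:R^-1.

Let w_ge0 p : 0 <= w p. Proof. by rewrite invr_ge0. Qed.

(* Ranks at most [j %/ (2 * e)] occur for at most [2 ^ (j / 2)] primes; the
   larger ones gain a factor [j] over Chebyshev's bound [O(1 / j)] for the sum
   of [1 / p] over the block. *)
Lemma sum_rank_dyadic (j : nat) : (0 < j)%N ->
  \sum_((2 ^ j).+1 <= p < (2 ^ j.+1).+1 | prime p) w p
    <= (8 + 4 * e)%:R / j%:R ^+ 2.
Proof.
move=> j_gt0; pose y := (j %/ (2 * e))%N.
pose c : R := (2 ^ j)%:R^-1; pose d : R := (2 ^ j * y.+1)%:R^-1.
set s := index_iota _ _.
pose low p := (0 < z p <= y)%N.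
(* Each prime of the block exceeds 2^j. A low rank is bounded below by 1, giving [c]; a higher one
   by [y.+1], giving [d]. *)
have w_le p : p \in s -> w p <= (low p)%:R * c + d.
  rewrite mem_index_iota => /andP[lp _]; rewrite /w /low.
  have d0 : 0 <= d by rewrite invr_ge0.
  have [->|z0] := posnP (z p); first by rewrite muln0 invr0 mul0r add0r.
  have p0 : (0 < p)%N by lia.
  have [zy|zy] /= := leqP (z p) y.
    rewrite mul1r ler_wpDr// lef_pV2 ?posrE ?ltr0n ?muln_gt0 ?expn_gt0 ?p0//.
    by rewrite ler_nat; nia.
  rewrite mul0r add0r lef_pV2 ?posrE ?ltr0n ?muln_gt0 ?expn_gt0 ?p0//.
  by rewrite ler_nat; apply: leq_mul => //; apply: ltnW.
pose n1 := count (fun p => prime p && low p) s; pose n2 := count prime s.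
have sum_le : \sum_(p <- s | prime p) w p <= n1%:R * c + n2%:R * d.
  apply: (@le_trans _ _ (\sum_(p <- s | prime p) ((low p)%:R * c + d))).
    by rewrite big_seq_cond [leRHS]big_seq_cond ler_sum// => p /andP[/w_le].
  rewrite big_split /= -mulr_suml -natr_sum lerD//.
    rewrite ler_wpM2r ?invr_ge0// ler_nat /n1 -sum1_count big_mkcondr /=.
    by apply: leq_sum => p _; case: (low p).
  by rewrite /n2 -sum1_count natr_sum mulr_suml ler_sum// => p _; rewrite mul1r.
have ey_le : (e * y <= j %/ 2)%N.
  by rewrite leq_divRL// mulnC mulnA /y mulnC leq_trunc_div.
have lt_y : (j < y.+1 * (2 * e))%N by rewrite ltn_ceil// muln_gt0.
have n1_le : (n1 * j ^ 2 <= 8 * 2 ^ j)%N.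
  have h1 : (n1 <= 2 ^ (j %/ 2))%N.
    by apply: leq_trans (count_z _ _ _) _; rewrite leq_exp2l.
  (* With j = h + g and j <= 2 g, one has j^2 <= 4 g^2 <= 8 * 2^g, and the factor 2^h comes from the
     count. *)
  set h := (j %/ 2)%N in h1 *; pose g := (j - h)%N.
  have gh : (j = h + g)%N by rewrite subnKC// leq_div.
  have j2g : (j <= 2 * g)%N by rewrite /g /h; lia.
  have := sqr_le_exp2 g; have : (j ^ 2 <= 4 * g ^ 2)%N.
    by rewrite -[4%N]/(2 ^ 2)%N -expnMn leq_exp2r.
  rewrite {3}gh expnD => a1 a2.
  have a3 : (j ^ 2 <= 8 * 2 ^ g)%N by lia.
  by apply: leq_trans (leq_mul h1 a3) _; rewrite mulnCA.
have n2_le : (n2 * j ^ 2 <= 4 * e * (2 ^ j * y.+1))%N.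
  have := leq_mul (count_primes_dyadic j) (ltnW lt_y).
  by rewrite -/s -/n2 expnS -mulnn; lia.
have j20 : 0 < j%:R ^+ 2 :> R by rewrite exprn_gt0// ltr0n.
apply: le_trans sum_le _; rewrite natrD mulrDl lerD//.
  rewrite ler_pdivlMr// mulrAC ler_pdivrMr ?ltr0n ?expn_gt0//.
  by rewrite -natrX -!natrM ler_nat.
rewrite ler_pdivlMr// mulrAC ler_pdivrMr ?ltr0n ?muln_gt0 ?expn_gt0//.
by rewrite -natrX -!natrM ler_nat.
Qed.

(** The block bounds telescope, since 1 / (K + 1)^2 <= 1 / K - 1 / (K + 1). *)
Lemma sum_rank_exp2 (J K : nat) : (0 < J <= K)%N ->
  \sum_((2 ^ J.+1).+1 <= p < (2 ^ K.+1).+1 | prime p) w p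
    <= (8 + 4 * e)%:R * (J%:R^-1 - K%:R^-1).
Proof.
move=> /andP[J0]; elim: K => [|K IHK]; first by rewrite leqn0; case: eqP J0 => // ->.
rewrite leq_eqVlt => /orP[/eqP->|]; first by rewrite big_geq// subrr mulr0.
rewrite ltnS => JK.
rewrite (@big_cat_nat _ _ _ (2 ^ K.+1).+1)/= ?ltnS ?leq_exp2l//.
have := lerD (IHK JK) (sum_rank_dyadic K.+1 isT) => /le_trans; apply.
rewrite -mulrDr ler_wpM2l//.
have K0 : (0 : R) < K%:R by rewrite ltr0n (leq_trans J0).
have K1 : (0 : R) < K%:R + 1 by rewrite addr_gt0.
have J1 : (0 : R) < J%:R by rewrite ltr0n.
rewrite -lerBrDl -natr1.
have -> : J%:R^-1 - (K%:R + 1)^-1 - (J%:R^-1 - K%:R^-1)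
    = (K%:R * (K%:R + 1))^-1 :> R by field; rewrite !gt_eqF.
rewrite lef_pV2 ?posrE ?exprn_gt0 ?mulr_gt0// expr2 ler_pM2r//; lra.
Qed.

Lemma sum_rank_tail (eps : R) (B : nat) : 0 < eps ->
  exists2 P : nat, (B <= P)%N &
    forall N, \sum_(P <= p < N | prime p) w p <= eps.
Proof.
move=> eps_gt0; pose C : R := (8 + 4 * e)%:R.
pose J := (maxn B (Num.truncn (C / eps))).+1.
exists (2 ^ J.+1).+1.
  have := ltn_expl J.+1 (isT : (1 < 2)%N); rewrite /J; lia.
move=> N; pose K := maxn J N.
have J0 : (0 : R) < J%:R by rewrite ltr0n.
have CJ : C / J%:R <= eps.
  rewrite ler_pdivrMr// mulrC -ler_pdivrMr//.
  by apply: ltW; apply: lt_le_trans (truncnS_gt _) _; rewrite ler_nat ltnS leq_maxr.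
apply: le_trans CJ; have := @sum_rank_exp2 J K; rewrite /K leq_maxl => /(_ isT) h.
have NK : (N <= (2 ^ (maxn J N).+1).+1)%N.
  have := ltn_expl (maxn J N).+1 (isT : (1 < 2)%N); lia.
apply: (@le_trans _ _ (C * (J%:R^-1 - (maxn J N)%:R^-1))); last first.
  by rewrite ler_wpM2l// gerBl invr_ge0.
apply: le_trans h.
have [JN|NJ] := leqP (2 ^ J.+1).+1 N; last by rewrite big_geq ?sumr_ge0// ltnW.
by rewrite [leRHS](@big_cat_nat _ _ _ N)//= lerDl sumr_ge0.
Qed.

End RankSums.

(** * Counting in residue classes and periodic sets *)

Lemma count_mod_le (Q : pred nat) (L x : nat) : (0 < L)%N ->
  (forall m n, Q m -> Q n -> m = n %[mod L]) ->
  (count Q (iota 1 x) <= x %/ L + 1)%N.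
Proof.
move=> L_gt0 QL; rewrite -size_filter; set s := [seq n <- _ | _].
(* All members share one residue modulo [L], so the quotient determines the member. *)
have s_uniq : uniq [seq (n %/ L)%N | n <- s].
  rewrite map_inj_in_uniq; first by rewrite filter_uniq// iota_uniq.
  move=> m n; rewrite !mem_filter => /andP[Qm _] /andP[Qn _] eq_div.
  by rewrite (divn_eq m L) (divn_eq n L) eq_div (QL _ _ Qm Qn).
rewrite -(size_map (fun n => n %/ L)%N) -[leqRHS](size_iota 0).
apply: uniq_leq_size => // _ /mapP[n ns ->].
move: ns; rewrite mem_filter !mem_iota => /andP[_ /andP[_ nx]].
by rewrite /= add0n addn1 ltnS leq_div2r; lia.
Qed.

Lemma count_has_le (I : eqType) (D : pred I) (Q : I -> pred nat) (r : seq I)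
    (s : seq nat) :
  (count (fun n => has (fun i => D i && Q i n) r) s
    <= \sum_(i <- r | D i) count (Q i) s)%N.
Proof.
elim: r => [|i r IHr]; first by rewrite big_nil count_pred0.
rewrite big_cons; case: ifP => Di /=.
  apply: leq_trans (leq_add (leqnn _) IHr).
  rewrite -count_predUI; apply: leq_trans (leq_addr _ _).
  by apply: eq_leq; apply: eq_count => n /=; rewrite Di.
by apply: leq_trans IHr; apply: eq_leq; apply: eq_count => n /=; rewrite Di.
Qed.

Lemma count_periodic (f : pred nat) (Q k r : nat) :
  (forall n, f (n + Q)%N = f n) ->
  count f (iota 1 (k * Q + r))
    = (k * count f (iota 1 Q) + count f (iota 1 r))%N.
Proof.
move=> fQ; elim: k => [|k IHk]; first by rewrite !mul0n.
rewrite mulSn -addnA iotaD count_cat mulSn -addnA -IHk; congr addn.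
rewrite addnC iotaDl count_map; by apply: eq_count => n /=; rewrite addnC fQ.
Qed.

Lemma count_iota_le (f : pred nat) (m n : nat) : (count f (iota m n) <= n)%N.
Proof. by rewrite -[leqRHS](size_iota m) count_size. Qed.

(** Complete periods contribute exactly the mean; only the last, incomplete one causes an error. *)
Lemma count_periodic_approx (R : realType) (f : pred nat) (Q x : nat) :
  (0 < Q)%N -> (forall n, f (n + Q)%N = f n) ->
  `|(count f (iota 1 x))%:R - (count f (iota 1 Q))%:R / Q%:R * x%:R| <= Q%:R :> R.
Proof.
move=> Q0 fQ; rewrite (divn_eq x Q) count_periodic//.
have rQ := ltnW (ltn_pmod x Q0); set r := (x %% Q)%N in rQ *.
set k := (x %/ Q)%N.
have QR : (0 : R) < Q%:R by rewrite ltr0n.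
set t := count f (iota 1 Q); set v := count f (iota 1 r).
have -> : (k * t + v)%:R - t%:R / Q%:R * (k * Q + r)%:R
   = v%:R - t%:R / Q%:R * r%:R :> R.
  by rewrite !natrD !natrM; field; rewrite gt_eqF.
have v1 : v%:R <= Q%:R :> R by rewrite ler_nat (leq_trans (count_iota_le _ _ _)).
have v0 : 0 <= v%:R :> R by [].
have t1 : t%:R / Q%:R <= 1 :> R.
  by rewrite ler_pdivrMr// mul1r ler_nat count_iota_le.
have t0 : 0 <= t%:R / Q%:R :> R by rewrite divr_ge0.
have r1 : r%:R <= Q%:R :> R by rewrite ler_nat.
have r0 : 0 <= r%:R :> R by [].
rewrite ler_norml; apply/andP; split; nra.
Qed.

(** * The sieve by primes dividing both the linear value and the orbit term *)

Section Sieve.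
Variables (R : realType) (a b : nat) (z : nat -> nat).
Hypotheses (a_gt0 : (0 < a)%N) (b_gt0 : (0 < b)%N) (ab : coprime a b).
Hypothesis z_le : forall p, prime p -> (z p <= p)%N.
Hypothesis tail : forall (eps : R) (B : nat), 0 < eps ->
  exists2 P : nat, (B <= P)%N &
    forall N, \sum_(P <= p < N | prime p) (p * z p)%:R^-1 <= eps.

(** When [z] is the rank function and n >= 1, this says that the prime p divides both a n + b and
    a_n. *)
Let bad p n := [&& p %| a * n + b, 0 < z p & z p %| n]%N.

Lemma prime_dvd_value_coprime (p n : nat) :
  prime p -> (p %| a * n + b)%N -> coprime p a.
Proof.
move=> p_pr pn; rewrite prime_coprime//; apply/negP => pa.
have pb : (p %| b)%N by rewrite -(dvdn_addr b (dvdn_mulr n pa)).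
have : (p %| gcdn a b)%N by rewrite dvdn_gcd pa.
by move: ab; rewrite /coprime => /eqP->; rewrite Euclid_dvd1.
Qed.

(* The constraint [gcdn c M %| 2] forces [gcdn M (z p) <= 2] as soon as some
   [n] of the class is a multiple of [z p]; otherwise [z p %| M] could happen
   and the modulus would lose the factor [z p]. *)
Lemma count_bad_class (p M c x : nat) :
  prime p -> (b < p)%N -> (0 < M)%N -> ~~ (p %| M)%N -> (gcdn c M %| 2)%N ->
  (count (fun n => (n == c %[mod M]) && bad p n)%N (iota 1 x))%:R
    <= 2 / M%:R * x%:R * (p * z p)%:R^-1 + 1 :> R.
Proof.
move=> p_pr bp M0 pM cM; set Q := fun n => _.
case: (boolP (has Q (iota 1 x))) => [|hasnQ]; last first.
  have -> : count Q (iota 1 x) = 0%N by apply/eqP; rewrite -leqn0 leqNgt -has_count.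
  by rewrite addr_ge0// mulr_ge0 ?invr_ge0// mulr_ge0// divr_ge0.
move=> /hasP[n0 _ /andP[/eqP n0c /and3P[pn0 z0 zn0]]].
(* If z(p) = p, then p divides [n0], hence also b, although 0 < b < p. So z(p) is prime to p, and p
   splits off from the lcm below. *)
have z_lt : (z p < p)%N.
  rewrite ltn_neqAle z_le// andbT; apply: contraTneq zn0 => ->.
  apply/negP => p_n0; move: pn0; rewrite dvdn_addr ?dvdn_mull// => /dvdn_leq.
  by move=> /(_ b_gt0); rewrite leqNgt bp.
pose L := (p * lcmn M (z p))%N.
have cop_pz : coprime p (z p).
  by rewrite prime_coprime//; apply/negP => /dvdn_leq; lia.
have lcm0 : (0 < lcmn M (z p))%N by rewrite lcmn_gt0 M0.
have L0 : (0 < L)%N by rewrite muln_gt0 prime_gt0.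
have cop_lcm : coprime p (lcmn M (z p)).
  apply: (@coprime_dvdr _ (M * z p)%N).
    by rewrite dvdn_lcm dvdn_mulr//= dvdn_mull.
  by rewrite coprimeMr cop_pz prime_coprime// pM.
have gcd_le : (gcdn M (z p) <= 2)%N.
  apply: dvdn_leq => //; apply: dvdn_trans cM.
  rewrite -(gcdn_modl c) -n0c gcdn_modl dvdn_gcd dvdn_gcdl andbT.
  exact: dvdn_trans (dvdn_gcdr _ _) zn0.
have L_ge : (M * (p * z p) <= 2 * L)%N.
  by rewrite /L mulnCA -(muln_lcm_gcd M) mulnA mulnC leq_mul2r gcd_le orbT.
(* Modulo p the congruence holds because a is invertible there; modulo M and z(p) it is part of
   [Q]. *)
have congr_L m n : Q m -> Q n -> m = n %[mod L].
  wlog nm : m n / (n <= m)%N => [hw Qm Qn|].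
    by case/orP: (leq_total n m) => h; [|symmetry]; apply: hw.
  move=> /andP[/eqP mc /and3P[pm _ zm]] /andP[/eqP nc /and3P[pn _ zn]].
  apply/eqP; rewrite eqn_mod_dvd// Gauss_dvd// dvdn_lcm (dvdn_sub zm zn) andbT.
  rewrite -[(M %| _)%N]eqn_mod_dvd// mc nc eqxx andbT.
  rewrite -(Gauss_dvdr _ (prime_dvd_value_coprime _ _ p_pr pm)) mulnBr.
  by rewrite -(subnDr b) (dvdn_sub pm pn).
have := count_mod_le Q L x L0 congr_L; rewrite -(ler_nat R) natrD.
move=> /le_trans; apply; rewrite lerD2r.
apply: (@le_trans _ _ (x%:R / L%:R)).
  by rewrite ler_pdivlMr ?ltr0n// -natrM ler_nat leq_trunc_div.
have -> : 2 / M%:R * x%:R * (p * z p)%:R^-1 = x%:R * (2 / (M * (p * z p))%:R) :> R.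
  by rewrite [in RHS]natrM invfM; ring.
rewrite ler_wpM2l// ler_pdivlMr ?ltr0n ?muln_gt0 ?M0 ?(prime_gt0 p_pr)//.
by rewrite mulrC ler_pdivrMr ?ltr0n// -natrM ler_nat.
Qed.

(** Only primes up to a x + b can divide a value at some n <= x. Summing the bound for one prime,
    the main terms give the tail sum and the terms 1 give the prime count. *)
Lemma count_bad_class_tail (T : pred nat) (P M c x : nat) (eps : R) :
  (forall N, \sum_(P <= p < N | prime p) (p * z p)%:R^-1 <= eps) ->
  (b < P)%N -> (0 < M)%N -> (forall p, prime p -> (P <= p)%N -> ~~ (p %| M)%N) ->
  (gcdn c M %| 2)%N ->
  (forall n, T n -> (n == c %[mod M])%N /\
     exists p, [/\ prime p, (P <= p)%N & bad p n]) ->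
  (count T (iota 1 x))%:R
    <= 2 / M%:R * x%:R * eps + (count prime (index_iota 0 (a * x + b).+1))%:R :> R.
Proof.
move=> tailP bP M0 MP cM hT.
pose Q p n := (n == c %[mod M])%N && bad p n.
pose r := index_iota P (a * x + b).+1.
have le1 : (count T (iota 1 x) <= \sum_(p <- r | prime p) count (Q p) (iota 1 x))%N.
  apply: leq_trans (count_has_le _ _ _ _ _).
  rewrite -!size_filter; apply: uniq_leq_size.
    by rewrite filter_uniq// iota_uniq.
  move=> n; rewrite !mem_filter => /andP[/hT[nc [p [p_pr Pp bad_p]]] nx].
  rewrite nx andbT; apply/hasP; exists p; last by rewrite p_pr /Q nc.
  rewrite mem_index_iota Pp ltnS.
  case/and3P: bad_p => /dvdn_leq + _ _ => /(_ _)/leq_trans; apply.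
    by rewrite addn_gt0 b_gt0 orbT.
  rewrite leq_add2r leq_mul2l; move: nx; rewrite mem_iota; lia.
have cnt_r : (count prime r <= count prime (index_iota 0 (a * x + b).+1))%N.
  have [Pax|Pax] := leqP P (a * x + b).+1.
    by rewrite [leqRHS](@count_index_iota_cat _ 0%N P _)// leq_addl.
  by rewrite /r {1}/index_iota (eqP (ltnW Pax)).
move: le1; rewrite -(ler_nat R) natr_sum => /le_trans; apply.
apply: (@le_trans _ _ (\sum_(p <- r | prime p)
   (2 / M%:R * x%:R * (p * z p)%:R^-1 + 1))).
  rewrite big_seq_cond [leRHS]big_seq_cond ler_sum// => p.
  rewrite mem_index_iota => /andP[/andP[Pp _] p_pr].
  by apply: count_bad_class => //; [exact: leq_trans Pp|exact: MP].
rewrite big_split /= -mulr_sumr lerD//.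
  by apply: ler_wpM2l; [rewrite mulr_ge0// divr_ge0|exact: tailP].
have -> : \sum_(p <- r | prime p) 1 = (count prime r)%:R :> R.
  by rewrite -sum1_count natr_sum.
by rewrite ler_nat.
Qed.

(** Induction on the bound with the Chinese remainder theorem. At an odd prime the new residue is
    kept nonzero, so only the prime 2 can divide both [c] and [M]. *)
Lemma exists_good_class (P : nat) : (2 < P)%N -> exists M c : nat,
  [/\ (0 < M)%N, (forall p, prime p -> (p %| M)%N = (p < P)%N),
      coprime (a * c + b) M & (gcdn c M %| 2)%N].
Proof.
elim: P => // P IHP; rewrite ltnS leq_eqVlt => /orP[/eqP<-|P_gt2].
  (* The parity of [c] makes a c + b odd: for even b, coprimality forces a to be odd. *)
  exists 2%N, (~~ odd b : nat); split=> //; last 2 first.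
  - rewrite coprimen2 oddD oddM; case: (boolP (odd b)) => b_odd.
      by rewrite andbF.
    rewrite andbT; case: (boolP (odd a)) => // a_odd.
    move: ab; rewrite /coprime => /eqP gcd1.
    have : (2 %| gcdn a b)%N by rewrite dvdn_gcd !dvdn2 a_odd.
    by rewrite gcd1.
  - exact: dvdn_gcdr.
  - move=> p p_pr; rewrite dvdn_prime2//.
    by have := prime_gt1 p_pr; case: ltngtP => //; lia.
have [M [c [M0 hM cop cM]]] := IHP P_gt2.
case: (boolP (prime P)) => [P_pr|nP_pr]; last first.
  exists M, c; split=> // p p_pr; rewrite hM// ltnS [RHS]leq_eqVlt.
  by case: eqP => // eq_pP; move: nP_pr; rewrite -eq_pP p_pr.
(* One of r = 1, 2 works: if P divided both values, it would divide their difference a, which is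
   prime to P. *)
have [r [r0 rP ar]] :
    exists r, [/\ (0 < r)%N, (r < P)%N & ~~ (P %| a * r + b)%N].
  case: (boolP (P %| a * 1 + b)%N) => P1; last first.
    by exists 1%N; split=> //; apply: ltn_trans P_gt2.
  exists 2%N; split=> //; apply/negP => P2.
  have : (P %| a)%N.
    have := dvdn_sub P2 P1; rewrite subnDr; congr (_ %| _)%N; lia.
  move=> Pa; have := prime_dvd_value_coprime _ _ P_pr P1.
  by rewrite prime_coprime// Pa.
have MP : coprime M P by rewrite coprime_sym prime_coprime// hM// ltnn.
pose c' := chinese M P c r.
have cM' : (c' = c %[mod M])%N by apply: chinese_modl.
have cP' : (c' = r %[mod P])%N by apply: chinese_modr.
have lin q d : (c' = d %[mod q])%N -> (a * c' + b = a * d + b %[mod q])%N.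
  by move=> cq; rewrite -modnDml -modnMmr cq modnMmr modnDml.
exists (M * P)%N, c'; split.
- by rewrite muln_gt0 M0 prime_gt0.
- by move=> p p_pr; rewrite Euclid_dvdM// hM// dvdn_prime2// ltnS [RHS]leq_eqVlt orbC.
- rewrite coprimeMr -[X in X && _]coprime_modl (lin _ _ cM') coprime_modl cop.
  by rewrite coprime_sym prime_coprime// /dvdn (lin _ _ cP').
- rewrite Gauss_gcdl.
    by rewrite -(gcdn_modl c') cM' gcdn_modl.
  rewrite coprime_sym prime_coprime// /dvdn cP' -/(dvdn P r).
  by apply/negP => /dvdn_leq; lia.
Qed.

Let G n := `[< forall p, prime p -> ~~ bad p n >].

Let not_goodP n : ~~ G n -> exists2 p, prime p & bad p n.
Proof.
move=> /asboolPn/existsNP[p /not_implyP[p_pr /negP]]; rewrite negbK => bad_p.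
by exists p.
Qed.

(** Each prime of positive rank multiplies the period by p z(p); one of rank 0 is never bad. *)
Lemma truncated_good_periodic (P : nat) :
  exists2 Q : nat, (0 < Q)%N & forall n,
    all (fun p => ~~ (prime p && bad p (n + Q)%N)) (iota 0 P)
    = all (fun p => ~~ (prime p && bad p n)) (iota 0 P).
Proof.
elim: P => [|P [Q Q0 hQ]]; first by exists 1%N.
have bad_add p k n : (0 < z p)%N -> bad p (n + k * (p * z p))%N = bad p n.
  move=> z0; rewrite /bad z0 /= mulnDr addnAC dvdn_addl.
    by rewrite [in X in _ && X]dvdn_addl// !dvdn_mull.
  by do 2!apply: dvdn_mull; apply: dvdn_mulr.
have {}hQ k n : all (fun p => ~~ (prime p && bad p (n + k * Q)%N)) (iota 0 P)
    = all (fun p => ~~ (prime p && bad p n)) (iota 0 P).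
  by elim: k => [|k IHk]; rewrite ?addn0// mulSnr addnA hQ.
case: (boolP (prime P && (0 < z P)%N)) => [/andP[P_pr zP]|Pz].
  exists (P * z P * Q)%N => [|n]; first by rewrite !muln_gt0 zP Q0 prime_gt0.
  rewrite -addn1 iotaD !all_cat hQ /= add0n !andbT; congr (_ && ~~ (_ && _)).
  by rewrite mulnC bad_add.
exists Q => // n; have := hQ 1%N n; rewrite mul1n => hQ1.
rewrite -addn1 iotaD !all_cat hQ1 /= add0n !andbT; congr (_ && ~~ _).
by move: Pz; rewrite /bad; case: (prime P) => //= /negbTE->; rewrite /= !andbF.
Qed.

Lemma count_primes_value (eps : R) : 0 < eps -> exists C : R, forall x : nat,
  (count prime (index_iota 0 (a * x + b).+1))%:R <= eps * x%:R + C.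
Proof.
move=> eps0; have a0 : (0 : R) < a%:R by rewrite ltr0n.
have [C hC] := count_primes_little_o R (eps / a%:R) (divr_gt0 eps0 a0).
exists (eps / a%:R * b%:R + C) => x; apply: le_trans (hC _) _.
by rewrite natrD natrM mulrDr addrA mulrA divfK ?gt_eqF.
Qed.

Lemma count_good_approx (eps : R) : 0 < eps -> exists d C : R, forall x : nat,
  `|(count G (iota 1 x))%:R - d * x%:R| <= eps * x%:R + C.
Proof.
move=> eps0; have eps4 : 0 < eps / 4 by lra.
have eps2 : 0 < eps / 2 by lra.
have [P bP tailP] := tail _ b.+1 eps4.
have [C hC] := count_primes_value _ eps2.
have [Q Q0 hQ] := truncated_good_periodic P.
pose f n := all (fun p => ~~ (prime p && bad p n)) (iota 0 P).
exists ((count f (iota 1 Q))%:R / Q%:R), (Q%:R + C) => x.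
have near_f := count_periodic_approx R f Q x Q0 hQ.
pose T n := f n && ~~ G n.
have -> : (count G (iota 1 x))%:R
    = (count f (iota 1 x))%:R - (count T (iota 1 x))%:R :> R.
  apply/eqP; rewrite eq_sym subr_eq -natrD eqr_nat -count_predUI.
  (* The truncated good set [f] is the disjoint union of [G] and [T], where [T] fails only because
     of primes at least [P]. *)
  rewrite (@eq_count _ (predI G T) pred0) ?count_pred0 ?addn0; last first.
    by move=> n /=; rewrite /T; case: (G n); rewrite ?andbF.
  apply/eqP/eq_count => n /=; rewrite /T.
  case: (boolP (G n)) => /= [/asboolP Gn|_]; last by rewrite andbT.
  by apply/allP => p _; apply/negP => /andP[/Gn/negP].
have T_le : (count T (iota 1 x))%:R <= eps * x%:R + C.
  have hT n : T n -> (n == 0 %[mod 1])%N /\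
      exists p, [/\ prime p, (P <= p)%N & bad p n].
    rewrite !modn1 eqxx => /andP[fn /not_goodP[p p_pr bad_p]]; split=> //.
    exists p; split=> //; rewrite leqNgt; apply/negP => pP.
    by move: fn => /allP/(_ p); rewrite mem_iota pP p_pr bad_p => /(_ isT).
  have h1 p : prime p -> (P <= p)%N -> ~~ (p %| 1)%N.
    by move=> p_pr _; rewrite Euclid_dvd1.
  (* The trivial class modulo 1 is used: the tail costs 2 (eps / 4) x and the prime count (eps / 2)
     x + C. *)
  have := count_bad_class_tail T P 1 0 x _ tailP bP isT h1 isT hT.
  have := hC x; rewrite divr1; set X := x%:R; lra.
have T_ge : 0 <= (count T (iota 1 x))%:R :> R by [].
move: near_f; rewrite !ler_norml; set u := (count f _)%:R.
set v := (count T _)%:R in T_le T_ge *; set y := _ / _ * _ => /andP[h1 h2].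
have C_ge : 0 <= eps * x%:R + C by apply: le_trans T_le.
by apply/andP; split; lra.
Qed.

Lemma count_good_lower : exists2 d : R, 0 < d & exists C : R, forall x : nat,
  d * x%:R - C <= (count G (iota 1 x))%:R.
Proof.
have eighth : (0 : R) < 8^-1 by rewrite invr_gt0.
have [P bP tailP] := tail _ (b + 3) eighth.
have P3 : (2 < P)%N by lia.
have bP' : (b < P)%N by lia.
have [M [c [M0 hM cop cM]]] := exists_good_class P P3.
have MR : (0 : R) < M%:R by rewrite ltr0n.
have eps0 : 0 < (4 * M%:R)^-1 :> R by rewrite invr_gt0 mulr_gt0.
have [C hC] := count_primes_value _ eps0.
(* The class has density at least 1 / M; the tail removes (2 / M) (1 / 8) = 1 / (4 M) and the prime
   count another 1 / (4 M). *)
exists ((2 * M%:R)^-1); first by rewrite invr_gt0 mulr_gt0.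
exists (M%:R + C) => x.
pose f n := (n == c %[mod M])%N.
have fM n : f (n + M)%N = f n by rewrite /f modnDr.
have := count_periodic_approx R f M x M0 fM.
have f_ge1 : 1 <= (count f (iota 1 M))%:R :> R.
  rewrite ler1n -has_count; apply/hasP; have [c0|c_gt0] := posnP (c %% M).
    by exists M; rewrite ?mem_iota ?M0 ?add1n ?ltnSn// /f modnn c0.
  exists (c %% M)%N; last by rewrite /f modn_mod.
  by rewrite mem_iota c_gt0 add1n ltnS ltnW// ltn_pmod.
pose T n := f n && ~~ G n.
have hT n : T n -> (n == c %[mod M])%N /\
    exists p, [/\ prime p, (P <= p)%N & bad p n].
  move=> /andP[fn /not_goodP[p p_pr bad_p]]; split=> //.
  exists p; split=> //; rewrite leqNgt -hM//; apply/negP => pM.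
  case/and3P: bad_p => pn _ _.
  (* A prime below [P] divides [M], so it would divide a c + b, which is prime to [M]. *)
  have : (p %| a * c + b)%N.
    have h : (a * n + b = a * c + b %[mod p])%N.
      have ncp : (n = c %[mod p])%N.
        by rewrite -(modn_dvdm n pM) (eqP fn) modn_dvdm.
      by rewrite -modnDml -modnMmr ncp modnMmr modnDml.
    by rewrite /dvdn -h.
  move=> pc; have : (p %| gcdn (a * c + b) M)%N by rewrite dvdn_gcd pc.
  by move: cop; rewrite /coprime => /eqP->; rewrite Euclid_dvd1.
have MP p : prime p -> (P <= p)%N -> ~~ (p %| M)%N.
  by move=> p_pr; rewrite hM// -leqNgt.
have := count_bad_class_tail T P M c x _ tailP bP' M0 MP cM hT.
have le_fGT : (count f (iota 1 x))%:R
    <= (count G (iota 1 x))%:R + (count T (iota 1 x))%:R :> R.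
  rewrite -natrD ler_nat -count_predUI; apply: leq_trans (leq_addr _ _).
  apply: sub_count => n /= fn; rewrite /T fn /=; exact: orbN.
have := hC x; rewrite !invfM; set w := M%:R^-1.
have w0 : 0 < w by rewrite invr_gt0.
rewrite ler_norml => h1 h2 /andP[h3 _].
have h4 : w * x%:R <= (count f (iota 1 M))%:R * w * x%:R.
  by rewrite ler_wpM2r// ler_peMl// ltW.
lra.
Qed.

End Sieve.

(** * From approximate counts to a positive density *)

(** The ratio eventually stays within eps of a centre [d] that may depend on eps. This is a Cauchy
    condition at infinity, so completeness gives the limit. *)
Lemma has_density_pos (R : realType) (S : set nat) :
  (forall eps : R, 0 < eps -> exists d C : R, forall n : nat,
    `|(count (fun m => m \in S) (iota 1 n))%:R - d * n%:R| <= eps * n%:R + C) ->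
  (exists2 d : R, 0 < d & exists C : R, forall n : nat,
    d * n%:R - C <= (count (fun m => m \in S) (iota 1 n))%:R) ->
  exists d : R, has_density S d /\ 0 < d.
Proof.
move=> approx [d0 d0_gt0 [C0 lower]].
pose f (x : R) := (counting_fun S x)%:R / x.
have trunc (x : R) : 0 <= x -> (Num.truncn x)%:R <= x < (Num.truncn x)%:R + 1.
  by move=> x0; rewrite natr1; apply: truncn_itv.
have cvgf : cvg (f x @[x --> +oo]).
  apply/cauchy_cvgP/cauchy_exP => eps eps0.
  have eps2 : 0 < eps / 2 by lra.
  have [d [C hC]] := approx _ eps2; exists d.
  change (\forall x \near +oo, ball d eps (f x)); near=> x.
  have x1 : 1 <= x by near: x; apply: nbhs_pinfty_ge; rewrite num_real.
  (* Beyond this threshold the constant [C] and the error |d| from truncating x together stay below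
     eps x / 4. *)
  have xC : 4 * (`|C| + `|d|) / eps + 1 <= x.
    by near: x; apply: nbhs_pinfty_ge; rewrite num_real.
  have x0 : 0 < x by lra.
  have {}xC : 4 * (`|C| + `|d|) < eps * x.
    by rewrite [ltRHS]mulrC -ltr_pdivrMr//; apply: lt_le_trans xC; rewrite ltrDl.
  rewrite /= -ball_normE /= distrC /f.
  have -> : (counting_fun S x)%:R / x - d
      = ((counting_fun S x)%:R - d * x) / x by field; rewrite gt_eqF.
  rewrite normrM normfV (gtr0_norm x0) ltr_pdivrMr//.
  have /andP[tx xt] := trunc x (ltW x0).
  have := hC (Num.truncn x); rewrite -/(counting_fun S x).
  set N := (Num.truncn x)%:R in tx xt *; set k := (counting_fun S x)%:R => hN.
  have -> : k - d * x = (k - d * N) + d * (N - x) by ring.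
  apply: le_lt_trans (ler_normD _ _) _; rewrite normrM.
  have NX : `|N - x| <= 1 by rewrite ler_norml; lra.
  have dNx : `|d| * `|N - x| <= `|d| by rewrite ler_piMr.
  have := ler_norm C; have : eps / 2 * N <= eps / 2 * x by rewrite ler_wpM2l// ltW.
  by have := normr_ge0 d; have := normr_ge0 C; lra.
exists (lim (f x @[x --> +oo])); split; first exact: cvgf.
(* Half of [d0] is given up to absorb [C0] and the truncation of x. *)
apply: (@lt_le_trans _ _ (d0 / 2)); first by rewrite divr_gt0.
apply: limr_ge => //; near=> x.
have xC : 2 * (`|C0| + d0) / d0 + 1 <= x.
  by near: x; apply: nbhs_pinfty_ge; rewrite num_real.
have x0 : 0 < x.
  apply: lt_le_trans xC; rewrite ltr_wpDl//.
  by apply: divr_ge0; [rewrite mulr_ge0// addr_ge0// ltW|exact: ltW].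
have {}xC : 2 * (`|C0| + d0) < d0 * x.
  by rewrite [ltRHS]mulrC -ltr_pdivrMr//; apply: lt_le_trans xC; rewrite ltrDl.
rewrite /f ler_pdivlMr//.
have /andP[tx xt] := trunc x (ltW x0).
have := lower (Num.truncn x); rewrite -/(counting_fun S x).
have : d0 * x <= d0 * ((Num.truncn x)%:R + 1) by rewrite ler_wpM2l// ltW.
have := ler_norm C0; lra.
Unshelve. all: by end_near. Qed.

Theorem theorem1p3 (R : realType) (F : {poly int}) (a b : nat)
  (F_lead : 0 < lead_coef F) (F_deg : (2 <= (size F).-1)%N)
  (F_wandering : unbounded_seq (zero_orbit F))
  (a_gt0 : (0 < a)%N) (b_gt0 : (0 < b)%N) (ab_coprime : gcdn a b = 1%N) :
  exists d : R, has_density (coprime_set F a b) d /\ 0 < d.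
Proof.
have rank p : exists z : nat, (0 < p)%N ->
    (z <= p)%N /\ forall n, (p%:Z %| zero_orbit F n)%Z = (z %| n)%N.
  case: p => [|p]; first by exists 0%N.
  by have [z hz] := rank_of_apparition F p.+1 isT; exists z.
have [z hz] := choice rank.
have z_le p : prime p -> (z p <= p)%N by move=> /prime_gt0/hz[].
have z_dvd p n : prime p -> (p %| `|zero_orbit F n|)%N = (z p %| n)%N.
  by move=> /prime_gt0/hz[_ <-]; rewrite dvdzE.
have [E growth] := zero_orbit_growth F.
have orbit_gt0 n : (0 < n)%N -> (0 < `|zero_orbit F n|)%N.
  by move=> n_gt0; rewrite absz_gt0 zero_orbit_neq0.
have z_self p : prime p -> (p %| `|zero_orbit F (z p)|)%N by move=> /z_dvd->.
have count_z := count_small_rank _ z E orbit_gt0 growth z_self.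
have tail := sum_rank_tail R z (2 * E.+1) isT count_z.
have ab : coprime a b by apply/eqP.
pose bad p n := [&& p %| a * n + b, 0 < z p & z p %| n]%N.
pose G n := `[< forall p, prime p -> ~~ bad p n >].
have countE n : count (fun m => m \in coprime_set F a b) (iota 1 n)
    = count G (iota 1 n).
  apply: eq_in_count => m; rewrite mem_iota => /andP[m_gt0 _].
  apply/idP/idP => [|/asboolP Gm].
    rewrite inE => -[_ gcd1]; apply/asboolP => p p_pr.
    apply/negP => /and3P[p_val _ zm].
    have : (p %| gcdn (a * m + b) `|zero_orbit F m|)%N.
      by rewrite dvdn_gcd p_val z_dvd.
    by case: gcd1 => ->; rewrite Euclid_dvd1.
  rewrite inE; split=> //; congr Posz; apply/eqP.
  set g := gcdn _ _; apply: contraT => g1.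
  have g_gt0 : (0 < g)%N by rewrite gcdn_gt0 orbit_gt0 ?orbT.
  have p_pr : prime (pdiv g) by rewrite pdiv_prime// ltn_neqAle eq_sym g1.
  have := pdiv_dvd g; rewrite dvdn_gcd => /andP[p_val p_orb].
  have zm : (z (pdiv g) %| m)%N by rewrite -z_dvd.
  (* Not being bad leaves only rank 0 for this common prime factor, and 0 divides m only for m = 0,
     which m >= 1 excludes. *)
  have := Gm _ p_pr; rewrite /bad p_val zm andbT /= -eqn0Ngt => /eqP z0.
  by move: zm m_gt0; rewrite z0 dvd0n => /eqP->.
apply: has_density_pos => [eps eps_gt0|].
  have [d [C hC]] := count_good_approx R a b z a_gt0 b_gt0 ab z_le tail eps eps_gt0.
  by exists d, C => n; rewrite countE; apply: hC.
have [d d_gt0 [C hC]] := count_good_lower R a b z a_gt0 b_gt0 ab z_le tail.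
by exists d => //; exists C => n; rewrite countE; apply: hC.
Qed.
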